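(* For every integer $k\ge1$, the problem of $k$-SCF coloring the complete interval hypergraph $H_n=(V,\mathcal I)$ admits a 2-approximation algorithm; that is, there is a polynomial-time algorithm which, for every $n\ge 1$, outputs a $k$-SCF coloring of $H_n$ using at most $2\chi_k^*(H_n)$ colors.
   Context: The complete interval hypergraph $H_n=(V,\mathcal I)$ has $V=\{1,\dots,n\}$ and $\mathcal I=\{\{i,i+1,\dots,j\}\mid 1\le i\le j\le n\}$. A coloring $C:V\to\mathbb N$ is a $k$-strong conflict-free ($k$-SCF) coloring of $H_n$ if for every $e\in\mathcal I$: when $|e|\le k$ all points of $e$ have pairwise distinct colors; when $|e|>k$ there are at least $k$ colors each of which is assigned to exactly one point of $e$. $\chi_k^*(H_n)$ is the minimum number of colors (size of the range of $C$) over all $k$-SCF colorings of $H_n$. *)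

(* Defs.v *)
From mathcomp Require Import all_boot.
From mathcomp Require Import boolp.

Set Implicit Arguments.
Unset Strict Implicit.
Unset Printing Implicit Defensive.

(** * Strong conflict-free colorings of hypergraphs

    A hypergraph is a finite vertex type [T] together with its set of
    hyperedges [E : {set {set T}}]. *)

Section StrongConflictFree.
Variable T : finType.

Definition color_mult (C : T -> nat) (e : {set T}) (c : nat) : nat :=
  #|[set v in e | C v == c]|.

Definition unique_colors (C : T -> nat) (e : {set T}) : seq nat :=
  [seq c <- undup [seq C v | v in e] | color_mult C e c == 1].

Definition strong_cf (k : nat) (E : {set {set T}}) (C : T -> nat) : Prop :=
  forall e, e \in E ->
    (#|e| <= k -> {in e &, injective C}) /\
    (k < #|e| -> k <= size (unique_colors C e)).

Definition num_colors (C : T -> nat) : nat := size (undup (codom C)).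

Lemma strong_cf_inj k (E : {set {set T}}) (C : T -> nat) :
  injective C -> strong_cf k E C.
Proof.
move=> Cinj e _; split=> [_ u v _ _ /Cinj //|kle].
rewrite /unique_colors undup_id ?(map_inj_uniq Cinj) ?enum_uniq //.
rewrite (_ : filter _ _ = [seq C v | v in e]).
  by rewrite size_map -cardE ltnW.
apply/all_filterP/allP => c /mapP[v]; rewrite mem_enum => ve ->{c}.
rewrite /color_mult (_ : [set _ in _ | _] = [set v]) ?cards1 //.
apply/setP => u; rewrite !inE (inj_eq Cinj).
by apply: andb_idl => /eqP ->.
Qed.

Lemma strong_cf_exists k (E : {set {set T}}) :
  exists m, `[< exists C : T -> nat, strong_cf k E C /\ num_colors C = m >].
Proof.
exists (num_colors (fun v => enum_rank v : nat)).
apply/asboolP; exists (fun v => enum_rank v : nat); split=> //.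
by apply: strong_cf_inj => u v /val_inj/enum_rank_inj.
Qed.

Definition chi_scf (k : nat) (E : {set {set T}}) : nat :=
  ex_minn (strong_cf_exists k E).

End StrongConflictFree.

(** The complete interval hypergraph: the ordinal [i : 'I_n] stands for the
    point [i.+1] of {1, ..., n}. *)

Definition complete_interval (n : nat) : {set {set 'I_n}} :=
  [set [set v : 'I_n | p.1 <= v <= p.2] |
     p : 'I_n * 'I_n & p.1 <= p.2].

(** * Random access machines

    The machine of Cook and Reckhow ("Time bounded random access machines",
    1973) over nat-valued registers X_0, X_1, ..., with uniform cost.  There is
    no multiplication, so a step lengthens the longest value by at most one
    bit and uniform-cost time is polynomially related to Turing machine time. *)

Inductive instr : Type :=
| IConst of nat & nat        (* X_i <- c *)
| IAdd of nat & nat & nat    (* X_i <- X_j + X_l *)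
| ISub of nat & nat & nat    (* X_i <- X_j - X_l, truncated at 0 *)
| ILoad of nat & nat         (* X_i <- X_(X_j) *)
| IStore of nat & nat        (* X_(X_i) <- X_j *)
| IJump of nat & nat         (* go to instruction m if X_j > 0 *)
| IPrint of nat.             (* append X_j to the output *)

Definition program := seq instr.

Record config : Type :=
  Config { pc : nat; reg : nat -> nat; out : seq nat }.

Definition update (X : nat -> nat) (i x : nat) : nat -> nat :=
  fun j => if j == i then x else X j.

Definition exec (a : instr) (s : config) : config :=
  let: Config p X o := s in
  match a with
  | IConst i c => Config p.+1 (update X i c) o
  | IAdd i j l => Config p.+1 (update X i (X j + X l)) o
  | ISub i j l => Config p.+1 (update X i (X j - X l)) o
  | ILoad i j => Config p.+1 (update X i (X (X j))) o
  | IStore i j => Config p.+1 (update X (X i) (X j)) o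
  | IJump m j => Config (if 0 < X j then m else p.+1) X o
  | IPrint j => Config p.+1 X (rcons o (X j))
  end.

(** A program halts when the program counter leaves it; halted configurations
    are fixed by [step]. *)

Definition step (P : program) (s : config) : config :=
  if onth P (pc s) is Some a then exec a s else s.

Definition halted (P : program) (s : config) : bool := size P <= pc s.

Definition init (n : nat) : config :=
  Config 0 (fun i => if i == 0 then n else 0) [::].

Definition run (P : program) (n t : nat) : config := iter t (step P) (init n).

Definition outputs (P : program) (n : nat) (s : seq nat) : Prop :=
  exists t, halted P (run P n t) /\ out (run P n t) = s.

(** The bound is polynomial in [n], not in its bit length: the instance is the
    hypergraph on [n] points, and the answer lists [n] colors. *)

Definition polynomial_time (P : program) : Prop :=
  exists a d : nat, forall n, 0 < n -> halted P (run P n (a * n ^ d + a)).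

(* Main.v *)
(** Cut the points into blocks of [k] consecutive points.  The [j]-th point of
    the [b]-th block (j >= 0, b >= 1) gets the color [k * logn 2 b + j].  Points of a
    short interval lie in distinct residue classes mod [k]; a longer interval
    meets every class in consecutive blocks, one of which has the strictly
    largest 2-adic valuation, so each class provides a unique color.  With
    [2 ^ m * k <= n < 2 ^ m.+1 * k] this uses at most [(m + 2) * k] colors.

    For the lower bound, halve an interval of more than [k] points: one half
    contains at least [uphalf k] of the unique colors, and the other half avoids
    them.  Hence [chi >= k + m * uphalf k], at least half of [(m + 2) * k].

    A machine generates the colors with a table of [k * logn 2 b], filled by
    [logn 2 (2 * b) = logn 2 b + 1]; odd entries keep their initial value 0. *)

Require Import Defs.
From mathcomp Require Import all_boot.
From mathcomp Require Import boolp zify.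

Set Implicit Arguments.
Unset Strict Implicit.
Unset Printing Implicit Defensive.

(** * 2-adic valuations and the ruler color *)

Lemma logn2_between x y : 0 < x -> x < y -> logn 2 x = logn 2 y ->
  exists z, [/\ x < z, z < y & logn 2 x < logn 2 z].
Proof.
move=> x0 xy exy; have y0 : 0 < y by lia.
have [p cp ex] := pfactor_coprime (isT : prime 2) x0.
have [q cq ey] := pfactor_coprime (isT : prime 2) y0.
rewrite -exy in ey; set t := logn 2 x in ex ey *.
rewrite coprime2n in cp; rewrite coprime2n in cq.
have t0 : 0 < 2 ^ t by rewrite expn_gt0.
have pq : p < q by rewrite -(ltn_pmul2r t0) -ex -ey.
(* The odd parts [p < q] enclose the even number [p.+1], so [p.+1 * 2 ^ t] has a larger
   valuation. *)
have pq1 : p.+1 < q by rewrite ltn_neqAle pq andbT; apply: contraTneq cq => <- /=; rewrite cp.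
exists (p.+1 * 2 ^ t); split.
- by rewrite {1}ex ltn_pmul2r.
- by rewrite ey ltn_pmul2r.
- rewrite lognM // pfactorK // -[X in X < _]add0n ltn_add2r.
  by rewrite logn_gt0 mem_primes /= dvdn2 /= cp.
Qed.

Definition ruler_color (k v : nat) : nat := k * logn 2 (v %/ k).+1 + v %% k.

Lemma ruler_color_mod k v : ruler_color k v %% k = v %% k.
Proof. by rewrite /ruler_color mulnC modnMDl modn_mod. Qed.

Lemma ruler_color_logn k u v : 0 < k -> ruler_color k u = ruler_color k v ->
  logn 2 (u %/ k).+1 = logn 2 (v %/ k).+1.
Proof.
move=> k0 e; have := congr1 (divn^~ k) e.
by rewrite /ruler_color ![k * _]mulnC !divnMDl // !(divn_small (ltn_pmod _ k0)) !addn0.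
Qed.

Lemma ruler_color_bound k m v : 0 < k -> v < 2 ^ m * k ->
  ruler_color k v < m.+1 * k.
Proof.
move=> k0 vm; have le_m : logn 2 (v %/ k).+1 <= m.
  rewrite -(leq_exp2l _ _ (ltnSn 1)); apply: (@leq_trans (v %/ k).+1).
    by apply: dvdn_leq => //; apply: pfactor_dvdnn.
  by rewrite ltn_divLR.
have := ltn_pmod v k0; rewrite /ruler_color; nia.
Qed.

Lemma eq_mod_close k u v : u %% k = v %% k -> u <= v -> v < u + k -> u = v.
Proof.
move=> e uv vk; have k0 : 0 < k by lia.
have du := divn_eq u k; have dv := divn_eq v k; rewrite e in du.
have [lt|lt|eq_uv] := ltngtP (u %/ k) (v %/ k); last first.
- by rewrite eq_uv in du; apply: etrans du (esym dv).
- have : (v %/ k).+1 * k <= u %/ k * k by rewrite leq_mul2r lt orbT.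
  lia.
- have : (u %/ k).+1 * k <= v %/ k * k by rewrite leq_mul2r lt orbT.
  lia.
Qed.

(** * Colors forced on an interval, and the lower bound *)

Section Colorings.
Variables (n : nat) (C : 'I_n -> nat).
Implicit Types e : {set 'I_n}.

Definition segment (a L : nat) : {set 'I_n} := [set v : 'I_n | a <= v < a + L].

Lemma card_segment a L : a + L <= n -> #|segment a L| = L.
Proof.
elim: L a => [|L IH] a aL.
  by apply/eqP; rewrite cards_eq0; apply/eqP/setP => v; rewrite !inE; lia.
have an : a + L < n by lia.
rewrite (_ : segment a L.+1 = Ordinal an |: segment a L).
  by rewrite cardsU1 IH ?inE /=; lia.
by apply/setP => v; rewrite !inE -val_eqE /=; lia.
Qed.

Lemma segment_interval a L : 0 < L -> a + L <= n ->
  segment a L \in complete_interval n.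
Proof.
move=> L0 aL; have an : a < n by lia.
have bn : (a + L).-1 < n by lia.
apply/imsetP; exists (Ordinal an, Ordinal bn); rewrite ?inE /=; first lia.
by apply/setP => v; rewrite !inE /=; lia.
Qed.

Lemma interval_segment e : e \in complete_interval n ->
  exists a L, [/\ 0 < L, a + L <= n & e = segment a L].
Proof.
case/imsetP => -[a b]; rewrite inE /= => ab ->.
exists a, (b - a).+1; split => //; first by have := ltn_ord b; lia.
by apply/setP => v; rewrite !inE; lia.
Qed.

Lemma color_mult_eq1 e v0 : v0 \in e ->
  (forall v, v \in e -> C v = C v0 -> v = v0) -> color_mult C e (C v0) = 1.
Proof.
move=> v0e u0; rewrite /color_mult (_ : [set _ in _ | _] = [set v0]) ?cards1 //.
apply/setP => v; rewrite !inE; apply/andP/eqP => [[ve /eqP]|-> //].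
exact: u0.
Qed.

Lemma color_mult_gt0 e c : (0 < color_mult C e c) = (c \in [seq C v | v in e]).
Proof.
apply/card_gt0P/imageP => [[v]|[v ve ->]].
  by rewrite inE => /andP[ve /eqP <-]; exists v.
by exists v; rewrite inE ve eqxx.
Qed.

Lemma mem_unique_colors e c :
  (c \in unique_colors C e) = (color_mult C e c == 1).
Proof.
rewrite /unique_colors mem_filter mem_undup -color_mult_gt0.
by case: eqP => // ->.
Qed.

Definition palette e : seq nat := undup [seq C v | v in e].

Lemma mem_palette e c : (c \in palette e) = (0 < color_mult C e c).
Proof. by rewrite mem_undup color_mult_gt0. Qed.

Lemma size_palette_inj e : {in e &, injective C} -> size (palette e) = #|e|.
Proof.
move=> Cinj; rewrite /palette undup_id ?size_map -?cardE //.
rewrite map_inj_in_uniq ?enum_uniq // => u v.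
by rewrite !mem_enum; apply: Cinj.
Qed.

Lemma palette_codom e : size (palette e) <= num_colors C.
Proof.
apply: uniq_leq_size (undup_uniq _) _ => c; rewrite !mem_undup.
by case/imageP => v _ ->; apply: codom_f.
Qed.

Lemma color_multU e1 e2 c : [disjoint e1 & e2] ->
  color_mult C (e1 :|: e2) c = color_mult C e1 c + color_mult C e2 c.
Proof.
move=> dis; rewrite /color_mult -cardsUI [X in _ + X](_ : _ = 0).
  by rewrite addn0; apply: eq_card => v; rewrite !inE andb_orl.
apply/eqP; rewrite cards_eq0; apply/eqP/setP => v; rewrite !inE.
by case e1v: (v \in e1); rewrite //= (disjointFr dis e1v) andbF.
Qed.

(* A unique color of [e1 :|: e2] occurs in only one part, hence is absent from
   the palette of the other; the parts share out the [k] unique colors. *)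
Lemma palette_split k p e1 e2 : [disjoint e1 & e2] ->
  k <= size (unique_colors C (e1 :|: e2)) ->
  p <= size (palette e1) -> p <= size (palette e2) ->
  uphalf k + p <= size (palette (e1 :|: e2)).
Proof.
move=> dis kU p1 p2; set U := unique_colors C _ in kU.
have part (d1 d2 : {set 'I_n}) :
    e1 :|: e2 = d1 :|: d2 -> [disjoint d1 & d2] ->
    count (fun c => color_mult C d1 c == 1) U + size (palette d2)
      <= size (palette (e1 :|: e2)).
  move=> ed dd; rewrite -size_filter -size_cat; apply: uniq_leq_size.
    rewrite cat_uniq undup_uniq filter_uniq ?filter_uniq ?undup_uniq //= andbT.
    apply/hasPn => c; rewrite mem_palette mem_filter mem_unique_colors ed.
    by rewrite color_multU //; lia.
  move=> c; rewrite mem_cat mem_filter mem_unique_colors !mem_palette ed.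
  by rewrite color_multU //; lia.
have h1 := part e1 e2 erefl dis.
have h2 := part e2 e1 (setUC _ _).
rewrite disjoint_sym in h2; move/(_ dis) in h2.
(* Each unique color has multiplicity one in some part, so the counts sum to at least [k] and the
   larger is at least [uphalf k]. *)
suff : size U <= count (fun c => color_mult C e1 c == 1) U
                 + count (fun c => color_mult C e2 c == 1) U by lia.
rewrite -count_predUI; apply: leq_trans (leq_addr _ _).
rewrite leq_eqVlt eq_sym -all_count; apply/orP; left; apply/allP => c.
by rewrite mem_unique_colors color_multU //=; lia.
Qed.

(** Induction by doubling, for a fixed coloring and every start [a]: [k] consecutive points have
    distinct colors, and each doubling adds [uphalf k] by [palette_split]. *)
Lemma palette_segment_lower k m a : 0 < k ->
  strong_cf k (complete_interval n) C -> a + 2 ^ m * k <= n ->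
  k + m * uphalf k <= size (palette (segment a (2 ^ m * k))).
Proof.
move=> k0 scf; elim: m a => [|m IH] a.
  rewrite mul1n addn0 => ak.
  have [inj _] := scf _ (segment_interval k0 ak).
  by rewrite size_palette_inj ?card_segment //; apply: inj; rewrite card_segment.
set L := 2 ^ m * k in IH *.
have L0 : 0 < L by rewrite muln_gt0 expn_gt0 k0.
have kL : k <= L by rewrite leq_pmull ?expn_gt0.
rewrite expnS -mulnA -/L => aL.
have e12 : segment a (2 * L) = segment a L :|: segment (a + L) L.
  by apply/setP => v; rewrite !inE; lia.
rewrite mulSn addnCA e12; apply: palette_split; [|rewrite -e12|apply: IH; lia..].
  by apply/pred0P => v; rewrite /= !inE; lia.
have [|_] := scf (segment a (2 * L)); first by apply: segment_interval; lia.
by apply; rewrite card_segment //; lia.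
Qed.

End Colorings.

Lemma chi_scf_lower (T : finType) k (E : {set {set T}}) b :
  (forall C, strong_cf k E C -> b <= num_colors C) -> b <= chi_scf k E.
Proof.
move=> h; rewrite /chi_scf; case: ex_minnP => m /asboolP[C [scf <-]] _.
exact: h.
Qed.

Lemma chi_interval_small k n : 0 < n -> n <= k ->
  n <= chi_scf k (complete_interval n).
Proof.
move=> n0 nk; apply: chi_scf_lower => C scf.
have [inj _] := scf _ (@segment_interval n 0 n n0 (leqnn _)).
apply: leq_trans (palette_codom C (segment n 0 n)).
by rewrite size_palette_inj ?card_segment //; apply: inj; rewrite card_segment.
Qed.

Lemma chi_interval_lower k m n : 0 < k -> 2 ^ m * k <= n ->
  k + m * uphalf k <= chi_scf k (complete_interval n).
Proof.
move=> k0 mn; apply: chi_scf_lower => C scf.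
by apply: leq_trans (palette_codom C _); apply: (@palette_segment_lower _ _ k m 0).
Qed.

(** * The ruler coloring and its approximation ratio *)

Section RulerColoring.
Variables (k n : nat).
Hypothesis k0 : 0 < k.

Definition ruler_coloring (v : 'I_n) : nat := ruler_color k v.

Lemma unique_ruler_color a L j : k <= L -> a + L <= n -> j < k ->
  exists2 c, c \in unique_colors ruler_coloring (segment n a L) & c %% k = j.
Proof.
move=> kL aL jk.
(* The point of residue [j] is taken in the block of [a], or in the next block if that one precedes
   [a]. *)
have [w [aw wL wj]] : exists w, [/\ a <= w, w < a + L & w %% k = j].
  have ak := ltn_pmod a k0; have ea := divn_eq a k.
  have [le|lt] := leqP (a %% k) j.
    by exists (a %/ k * k + j); rewrite modnMDl modn_small //; split=> //; lia.
  exists ((a %/ k).+1 * k + j); rewrite modnMDl modn_small //; split=> //; nia.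
have wn : w < n by lia.
pose P := [pred v in segment n a L | v %% k == j].
have Pw : P (Ordinal wn) by rewrite /= !inE /= wj eqxx aw wL.
case: (arg_maxnP (fun v : 'I_n => logn 2 (v %/ k).+1) Pw) => v /andP[ve /eqP vj] vmax.
(* Two points of maximal valuation would enclose a block of larger valuation, whose point of residue
   [j] is also in the segment. Blocks count from 1 in [logn], hence [z.-1] below. *)
have no_twin (x y : 'I_n) : x \in segment n a L -> y \in segment n a L ->
    x %% k = j -> y %% k = j -> logn 2 (x %/ k).+1 = logn 2 (v %/ k).+1 ->
    logn 2 (y %/ k).+1 = logn 2 (v %/ k).+1 -> ~ x < y.
  rewrite !inE => xe ye xj yj xv yv xy.
  have dx := divn_eq x k; have dy := divn_eq y k.
  rewrite xj in dx; rewrite yj in dy.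
  have xyk : x %/ k < y %/ k by nia.
  have [|||z [xz zy vz]] := @logn2_between (x %/ k).+1 (y %/ k).+1; rewrite ?xv //.
  have xzk : x %/ k * k <= z.-1 * k by rewrite leq_mul2r; lia.
  have zyk : z.-1 * k <= y %/ k * k by rewrite leq_mul2r; lia.
  have zk : z.-1 * k + j < n by have := ltn_ord y; lia.
  have zj : (z.-1 * k + j) %% k = j by rewrite modnMDl modn_small.
  have : P (Ordinal zk) by rewrite /= !inE /= zj eqxx andbT; lia.
  move/vmax => /=; rewrite divnMDl // divn_small // addn0 (prednK (leq_ltn_trans (leq0n _) xz)).
  by rewrite leqNgt -xv vz.
exists (ruler_coloring v); last by rewrite ruler_color_mod.
rewrite mem_unique_colors; apply/eqP/color_mult_eq1 => // u ue cuv.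
have uj : u %% k = j by rewrite -ruler_color_mod [ruler_color _ _]cuv ruler_color_mod.
have ul := ruler_color_logn k0 cuv.
apply/val_inj/eqP; rewrite eqn_leq; apply/andP; split; rewrite leqNgt; apply/negP.
  exact: (no_twin v u ve ue vj uj erefl ul).
exact: (no_twin u v ue ve uj vj ul erefl).
Qed.

Lemma ruler_coloring_scf : strong_cf k (complete_interval n) ruler_coloring.
Proof.
move=> e /interval_segment[a [L [L0 aL ->]]]; rewrite card_segment //; split.
  move=> Lk u v; rewrite !inE => ue ve cuv; apply: val_inj => /=.
  have muv : u %% k = v %% k by rewrite -ruler_color_mod [ruler_color _ _]cuv ruler_color_mod.
  have [le|/ltnW le] := leqP u v; last symmetry; apply: (@eq_mod_close k) => //; lia.
(* Reduction mod [k] maps the unique colors onto all [k] residues. *)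
move=> /ltnW kL; rewrite -[X in X <= _](size_iota 0) -[X in _ <= X](size_map (modn^~ k)).
apply: uniq_leq_size (iota_uniq _ _) _ => j; rewrite mem_iota /= => jk.
by have [c cU <-] := unique_ruler_color kL aL jk; apply: map_f.
Qed.

Lemma num_colors_ruler m : n <= 2 ^ m * k -> num_colors ruler_coloring <= m.+1 * k.
Proof.
move=> nm; rewrite -[X in _ <= X](size_iota 0).
apply: uniq_leq_size (undup_uniq _) _ => c; rewrite mem_undup mem_iota /=.
by case/codomP => v ->; apply: ruler_color_bound => //; apply: leq_trans nm.
Qed.

Lemma ruler_coloring_2approx : 0 < n ->
  num_colors ruler_coloring <= 2 * chi_scf k (complete_interval n).
Proof.
move=> n0; have [nk|/ltnW kn] := leqP n k.
  have le_n : num_colors ruler_coloring <= n.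
    by apply: leq_trans (size_undup _) _; rewrite size_codom card_ord.
  by have := chi_interval_small n0 nk; lia.
have q0 : 0 < n %/ k by rewrite divn_gt0.
have /andP[lo hi] := trunc_log_bounds (ltnSn 1) q0.
set m := trunc_log 2 _ in lo hi.
rewrite leq_divRL // in lo; rewrite ltn_divLR // in hi.
have := chi_interval_lower k0 lo; have := num_colors_ruler (ltnW hi).
(* This makes twice the lower bound at least [(m + 2) * k]. *)
have : k <= 2 * uphalf k by lia.
nia.
Qed.

End RulerColoring.

(** * The machine and its running time *)

(* Register 0 counts the points left, 3 those left in the current block [b]; the
   table entry of [a] is register [7 + a], and 4, 5 point to the entries of [b]
   and [2 * b].  Instructions 5 to 18 color one point; 14 to 17 pass to the next
   block. *)
Definition ruler_program (k : nat) : program :=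
  [:: IConst 1 1; IConst 2 k; IConst 3 k; IConst 4 8; IConst 5 9;
      ILoad 6 4; IAdd 7 6 2; IStore 5 7;
      ISub 7 2 3; IAdd 7 6 7; IPrint 7; ISub 0 0 1; ISub 3 3 1; IJump 18 3;
      IAdd 4 4 1; IAdd 5 5 1; IAdd 5 5 1; IConst 3 k;
      IJump 5 0].

(** State at instruction 5 once [v] points are colored, with [b = (v %/ k).+1]. Even entries are
    guaranteed only below [2 * b]. Requiring [0 < a] leaves register 7 free as scratch. *)
Record loop_inv (k n v : nat) (X : nat -> nat) : Prop := LoopInv {
  inv_points_left : X 0 = n - v;
  inv_one : X 1 = 1;
  inv_k : X 2 = k;
  inv_block_left : X 3 = k - v %% k;
  inv_read : X 4 = 8 + v %/ k;
  inv_write : X 5 = 9 + 2 * (v %/ k);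
  inv_table : forall a, 0 < a -> odd a || (a < 2 * (v %/ k).+1) ->
    X (7 + a) = k * logn 2 a }.

(** Entry [b] is readable since [b < 2 * b], and the written entry [2 * b] is one the invariant does
    not constrain. Every point of the block repeats the same store. *)
Lemma ruler_store k n v X o : loop_inv k n v X ->
  exists2 Y, iter 3 (step (ruler_program k)) (Config 5 X o) = Config 8 Y o &
    [/\ loop_inv k n v Y, Y 6 = k * logn 2 (v %/ k).+1 &
        Y (7 + 2 * (v %/ k).+1) = k * logn 2 (2 * (v %/ k).+1)].
Proof.
case=> h0 h1 h2 h3 h4 h5 ht; have color := ht (v %/ k).+1.
eexists; first reflexivity.
have l2 : logn 2 (2 * (v %/ k).+1) = (logn 2 (v %/ k).+1).+1 by rewrite lognM.
have X4 : X (X 4) = k * logn 2 (v %/ k).+1.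
  by rewrite h4 -[8]/(7 + 1) -addnA add1n color // ltn_Pmull ?orbT.
split; first split.
1-6: by rewrite /update /= h5.
- move=> a a0 ha; rewrite /update /= h5.
  rewrite ifF ?ifF; try lia; exact: ht.
- by rewrite /update /= h5 X4.
- rewrite /update /= h5 ifT; last lia.
  by rewrite X4 h2 l2 mulnS addnC.
Qed.

Lemma ruler_body k n v X o : 0 < k -> v < n -> loop_inv k n v X ->
  exists t Y, [/\ t <= 14, loop_inv k n v.+1 Y &
    iter t (step (ruler_program k)) (Config 5 X o)
      = Config (if v.+1 < n then 5 else 19) Y (rcons o (ruler_color k v))].
Proof.
move=> k0 vn /(ruler_store o)[Y eY [[h0 h1 h2 h3 h4 h5 ht] h6 hq]].
have vk := ltn_pmod v k0; have dv := divn_eq v k.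
pose Z := update (update (update (update Y 7 (Y 2 - Y 3))
  7 (Y 6 + (Y 2 - Y 3))) 0 (Y 0 - Y 1)) 3 (Y 3 - Y 1).
have eZ : iter 6 (step (ruler_program k)) (Config 8 Y o)
    = Config (if 0 < Y 3 - Y 1 then 18 else 14) Z (rcons o (ruler_color k v)).
  rewrite (_ : ruler_color k v = Y 6 + (Y 2 - Y 3)) //.
  by rewrite h6 h2 h3 /ruler_color; lia.
have Z0 : (0 < Z 0) = (v.+1 < n) by rewrite /Z /update /= h0 h1; lia.
(* Inside a block, instruction 13 jumps to 18: [3 + 6 + 1] steps. At its end, 14 to 17 run too:
   [3 + 6 + 5] steps. *)
have [lt|ge] := ltnP (v %% k).+1 k.
  have qv : v.+1 %/ k = v %/ k.
    by rewrite {1}dv -addnS divnMDl // (divn_small lt) addn0.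
  have rv : v.+1 %% k = (v %% k).+1.
    by rewrite {1}dv -addnS modnMDl modn_small.
  exists 10, Z; split => //.
    split; rewrite ?qv ?rv /Z /update /= ?h0 ?h1 ?h2 ?h3 //; try lia.
    by case=> // a; apply: ht.
  rewrite -[10]/(1 + (6 + 3)) iterD [iter (6 + 3) _ _]iterD eY eZ ifT; last lia.
  by rewrite -Z0.
have qv : v.+1 %/ k = (v %/ k).+1.
  by rewrite (_ : v.+1 = (v %/ k).+1 * k + 0) ?divnMDl ?div0n ?addn0 //; lia.
have rv : v.+1 %% k = 0.
  by rewrite (_ : v.+1 = (v %/ k).+1 * k + 0) ?addn0 ?modnMl //; lia.
pose W := update (update (update (update Z 4 (Y 4 + Y 1)) 5 (Y 5 + Y 1))
  5 (Y 5 + Y 1 + Y 1)) 3 k.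
exists 14, W; split => //.
  split; rewrite ?qv ?rv /W /Z /update /= ?h0 ?h1 ?h2 ?h3 ?h4 ?h5 //; try lia.
  (* The only newly guaranteed entry is [2 * b], just stored. *)
  case=> // a _ ha; have [ea|ne] := eqVneq a.+1 (2 * (v %/ k).+1).
    by rewrite ea; apply: hq.
  by apply: ht => //; lia.
rewrite -[14]/(5 + (6 + 3)) iterD [iter (6 + 3) _ _]iterD eY eZ ifF; last lia.
by rewrite -Z0.
Qed.

Lemma ruler_loop k n v : 0 < k -> v <= n -> 0 < n ->
  exists t Y, [/\ t <= 5 + v * 14, loop_inv k n v Y &
    run (ruler_program k) n t
      = Config (if v < n then 5 else 19) Y [seq ruler_color k i | i <- iota 0 v]].
Proof.
move=> k0 vn n0; elim: v vn => [|v IH] vn.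
  exists 5; eexists; split; [by []| |by rewrite n0; reflexivity].
  split; rewrite /update ?div0n ?mod0n ?subn0 ?muln0 ?addn0 //=.
  (* No positive even [a] is below 2, and for odd [a] the initial 0 is the right value. *)
  move=> a a0; rewrite muln1 => /orP[oa|]; first by rewrite lognE dvdn2 oa andbF muln0.
  by case: a a0 => [|[]] //= _ _; rewrite logn1 muln0.
have [t [X [tv hX eX]]] := IH (ltnW vn).
rewrite vn in eX.
have [t' [Y [t'14 hY eY]]] := ruler_body [seq ruler_color k i | i <- iota 0 v] k0 vn hX.
exists (t' + t), Y; split => //; first lia.
by rewrite /run iterD -/(run _ _ _) eX eY -map_rcons -cats1 -(iotaD 0 v 1) addn1.
Qed.

Lemma ruler_halts k n : 0 < k -> 0 < n ->
  exists t, [/\ t <= 5 + n * 14, halted (ruler_program k) (run (ruler_program k) n t)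
    & out (run (ruler_program k) n t) = codom (@ruler_coloring k n)].
Proof.
move=> k0 n0; have [t [X [tn _ eX]]] := ruler_loop k0 (leqnn n) n0.
exists t; split; rewrite ?eX /halted ?ltnn //=.
by rewrite -val_enum_ord -map_comp.
Qed.

(** Needed because [polynomial_time] tests halting at one prescribed time, possibly after the actual
    stop. *)
Lemma run_halted P n t u : t <= u -> halted P (run P n t) -> run P n u = run P n t.
Proof.
move=> tu h; rewrite -(subnK tu) /run iterD -/(run P n t).
by elim: (u - t) => //= d ->; rewrite /step onth_default.
Qed.

Theorem theorem6 (k : nat) (hk : 1 <= k) :
  exists P : program,
    polynomial_time P /\
    forall n : nat, 1 <= n ->
      exists C : 'I_n -> nat,
        [/\ outputs P n (codom C),
            strong_cf k (complete_interval n) C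
          & num_colors C <= 2 * chi_scf k (complete_interval n)].
Proof.
exists (ruler_program k); split.
  exists 14, 1 => n n0; have [t [tn ht _]] := ruler_halts hk n0.
  by rewrite (@run_halted _ _ t) // expn1; lia.
move=> n n0; exists (@ruler_coloring k n); split.
- by have [t [_ ht et]] := ruler_halts hk n0; exists t.
- exact: ruler_coloring_scf.
- exact: ruler_coloring_2approx.
Qed.
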